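(* Let $A\in\mathbb{R}^{n\times n}$ with $\rho(A)<1$, $C\in\mathbb{R}^{m\times n}$, $Q\in\mathbb{R}^{n\times n}$ with $Q\ge 0$, and $R\in\mathbb{R}^{m\times m}$ with $R>0$. Let $\mathcal{P}(K)$, $\mathcal{S}(K)$ and $K_{\mathrm{kf}}$ be as defined in the context, and for $\delta\ge\mathcal P(K_{\mathrm{kf}})$ let $$\mathcal S^*(\delta)=\min_{K}\ \mathcal{S}(K)\quad\text{subject to}\quad \mathcal{P}(K)\le\delta ,$$ where $K$ ranges over all $K\in\mathbb{R}^{n\times m}$ with $\rho(A-KCA)<1$. Then $\mathcal S^*(\delta)$ is a strictly decreasing function of $\delta$ on the interval $\delta\in[\mathcal P(K_{\mathrm{kf}}),\mathcal P(0)]$.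
   Context: All matrices are real; $\rho(\cdot)$ is the spectral radius; $M\ge0$ ($M>0$) means symmetric positive semidefinite (definite). Consider the system $x(t+1)=Ax(t)+w(t)$, $y(t)=Cx(t)+v(t)$, with $w(t)\sim\mathcal N(0,Q)$, $v(t)\sim\mathcal N(0,R)$, $x(0)\sim\mathcal N(0,\Sigma_0)$ independent of each other at all times, and the linear filter $\hat x(t+1)=A\hat x(t)+K[y(t+1)-CA\hat x(t)]$ with constant gain $K\in\mathbb{R}^{n\times m}$. Write $A_K=A-KCA$ and $B_K=I_n-KC$. Only gains $K$ with $\rho(A_K)<1$ are considered. For such $K$, the steady-state error covariance $P(K)\ge0$ is the unique solution of $P(K)=A_KP(K)A_K^{\mathsf T}+B_KQB_K^{\mathsf T}+KRK^{\mathsf T}$, and the error is $\mathcal P(K)=\mathrm{Tr}(P(K))$. The sensitivity is $\mathcal S(K)=\mathrm{Tr}\left[\frac{d}{dR}\mathcal P(K)\right]$, where $\frac{d}{dR}\mathcal P(K)$ is the $m\times m$ matrix gradient of $\mathcal P(K)$ with respect to $R$ (with $A,C,Q,K$ fixed), i.e. the matrix $G$ with $d\mathcal P(K)=\mathrm{Tr}(G^{\mathsf T}dR)$. Equivalently, $\mathcal S(K)=\mathrm{Tr}(S(K))$, where $S(K)\ge0$ solves $S(K)=A_KS(K)A_K^{\mathsf T}+KK^{\mathsf T}$. $K_{\mathrm{kf}}$ is the steady-state Kalman filter gain, which minimizes $\mathcal P(K)$: $K_{\mathrm{kf}}=\Sigma C^{\mathsf T}(C\Sigma C^{\mathsf T}+R)^{-1}$,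 where $\Sigma\ge0$ is the unique positive semidefinite solution of $\Sigma=A\Sigma A^{\mathsf T}-A\Sigma C^{\mathsf T}(C\Sigma C^{\mathsf T}+R)^{-1}C\Sigma A^{\mathsf T}+Q$. *)

(* Defs.v *)
From mathcomp Require Import all_boot all_order all_algebra.
From mathcomp Require Import all_classical all_reals all_analysis.
From mathcomp.real_closed Require Import complex.
Import Order.TTheory GRing.Theory Num.Theory.
Import numFieldNormedType.Exports.

Set Implicit Arguments.
Unset Strict Implicit.
Unset Printing Implicit Defensive.

Local Open Scope classical_set_scope.
Local Open Scope ring_scope.

Definition psd (F : realType) (n : nat) (M : 'M[F]_n) : Prop :=
  M^T = M /\ forall v : 'cV[F]_n, 0 <= (v^T *m M *m v) ord0 ord0.

Definition pd (F : realType) (n : nat) (M : 'M[F]_n) : Prop :=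
  M^T = M /\ forall v : 'cV[F]_n, v != 0 -> 0 < (v^T *m M *m v) ord0 ord0.

(* The eigenvalues are complex. If n = 0 there are none, and sup set0 = 0. *)
Definition spectral_radius (F : realType) (n : nat) (M : 'M[F]_n) : F :=
  sup [set ComplexField.Normc.normc z
      | z in [set z : F[i] | eigenvalue (map_mx (real_complex F) M) z]].

Definition stabilizing (F : realType) (n m : nat) (A : 'M[F]_n)
    (C : 'M[F]_(m, n)) (K : 'M[F]_(n, m)) : Prop :=
  spectral_radius (A - K *m C *m A) < 1.

(* The solution is selected among all square matrices: for a stabilizing K it
   is unique there, and it is automatically positive semidefinite when Q and R
   are. Not imposing positivity makes the covariance a function of an arbitrary
   m x m matrix R, which the gradient with respect to R below requires. *)
Definition err_cov (F : realType) (n m : nat) (A : 'M[F]_n) (C : 'M[F]_(m, n))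
    (Q : 'M[F]_n) (K : 'M[F]_(n, m)) (R : 'M[F]_m) : 'M[F]_n :=
  let AK := A - K *m C *m A in
  let BK := 1%:M - K *m C in
  xget 0 [set P | P = AK *m P *m AK^T + BK *m Q *m BK^T + K *m R *m K^T].

Definition filter_error (F : realType) (n m : nat) (A : 'M[F]_n)
    (C : 'M[F]_(m, n)) (Q : 'M[F]_n) (R : 'M[F]_m) (K : 'M[F]_(n, m)) : F :=
  \tr (err_cov A C Q K R).

(* The matrix G such that df = Tr(G^T dX). *)
Definition matrix_gradient (F : realType) (p q : nat) (f : 'M[F]_(p, q) -> F)
    (X : 'M[F]_(p, q)) : 'M[F]_(p, q) :=
  xget 0 [set G | differentiable f X /\
                  forall H : 'M[F]_(p, q), 'd f X H = \tr (G^T *m H)].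

Definition sensitivity (F : realType) (n m : nat) (A : 'M[F]_n)
    (C : 'M[F]_(m, n)) (Q : 'M[F]_n) (R : 'M[F]_m) (K : 'M[F]_(n, m)) : F :=
  \tr (matrix_gradient (fun R' => filter_error A C Q R' K) R).

Definition riccati_sol (F : realType) (n m : nat) (A : 'M[F]_n)
    (C : 'M[F]_(m, n)) (Q : 'M[F]_n) (R : 'M[F]_m) : 'M[F]_n :=
  xget 0 [set S | psd S /\
    S = A *m S *m A^T
        - A *m S *m C^T *m invmx (C *m S *m C^T + R) *m C *m S *m A^T + Q].

Definition kalman_gain (F : realType) (n m : nat) (A : 'M[F]_n)
    (C : 'M[F]_(m, n)) (Q : 'M[F]_n) (R : 'M[F]_m) : 'M[F]_(n, m) :=
  let S := riccati_sol A C Q R in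
  S *m C^T *m invmx (C *m S *m C^T + R).

Definition feasible (F : realType) (n m : nat) (A : 'M[F]_n)
    (C : 'M[F]_(m, n)) (Q : 'M[F]_n) (R : 'M[F]_m) (delta : F)
    (K : 'M[F]_(n, m)) : Prop :=
  stabilizing A C K /\ filter_error A C Q R K <= delta.

Definition is_min_sensitivity (F : realType) (n m : nat) (A : 'M[F]_n)
    (C : 'M[F]_(m, n)) (Q : 'M[F]_n) (R : 'M[F]_m) (delta s : F) : Prop :=
  (exists K, feasible A C Q R delta K /\ sensitivity A C Q R K = s) /\
  forall K, feasible A C Q R delta K -> s <= sensitivity A C Q R K.

Definition min_sensitivity (F : realType) (n m : nat) (A : 'M[F]_n)
    (C : 'M[F]_(m, n)) (Q : 'M[F]_n) (R : 'M[F]_m) (delta : F) : F :=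
  xget 0 [set s | is_min_sensitivity A C Q R delta s].

(* Main.v *)
From HB Require Import structures.
Require Import Defs.
From mathcomp Require Import all_boot all_order all_algebra.
From mathcomp Require Import all_classical all_reals all_analysis.
From mathcomp.real_closed Require Import complex.
From mathcomp Require Import ring lra.
Import Order.TTheory GRing.Theory Num.Theory.
Import numFieldNormedType.Exports.

Set Implicit Arguments.
Unset Strict Implicit.
Unset Printing Implicit Defensive.

Local Open Scope classical_set_scope.
Local Open Scope ring_scope.

(** The sensitivity [S(K)] is the error of a filter with process noise 0 and measurement
    noise 1, and its only local minimum over the stabilizing gains is [K = 0].  Indeed, let
    [S = A_K S A_K^T + K K^T], [H = C A], [W = H S H^T + 1] and [L = A S H^T W^-1], the gain
    minimizing [X |-> (A - X H) S (A - X H)^T + X X^T].  Moving from [K] towards [L] keeps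
    the gain stabilizing and strictly decreases the sensitivity, unless [K = L]; in that case
    [S <= A S A^T], hence [S = 0] and [K = 0].  As [P(K)] varies continuously along this
    segment, an optimal gain for [delta1], which is not 0 since [P(K) <= delta1 < P(0)], can
    be improved within the budget [delta2 > delta1].

    The minimum is attained because a solution [S >= 0] of [S = A_K S A_K^T + K K^T] already
    forces [A_K] to be stable when [A] is: the triples [(K, P, S)] satisfying both Lyapunov
    equations and the trace bounds form a compact set.  The Kalman gain provides a feasible
    point; any positive semidefinite Riccati solution suffices for that, and if there were
    none, [riccati_sol] would be 0 and the gain 0 would be feasible. *)

(** * Spectral radius and decay of orbits *)

Notation normc := ComplexField.Normc.normc.
Notation toC := (real_complex _).

Lemma normc_ge0 (F : rcfType) (z : F[i]) : 0 <= normc z.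
Proof. by case: z => x y; exact: sqrtr_ge0. Qed.

Lemma char_poly_roots (F : realType) (n : nat) (M : 'M[F[i]]_n) :
  {r : seq F[i] | char_poly M = \prod_(z <- r) ('X - z%:P) &
    forall z, eigenvalue M z = (z \in r)}.
Proof.
have [r rE] := closed_field_poly_normal (char_poly M).
have {}rE : char_poly M = \prod_(z <- r) ('X - z%:P).
  by rewrite rE (monicP (char_poly_monic M)) scale1r.
by exists r => // z; rewrite eigenvalue_root_char rE root_prod_XsubC.
Qed.

(** The eigenvalues are the finitely many roots of the characteristic polynomial, so the supremum is
    bounded by their largest modulus, and it is 0 when there are none. *)
Lemma spectral_radius_lt1_normc (F : realType) (n : nat) (M : 'M[F]_n) :
  spectral_radius M < 1 <->
  forall z, eigenvalue (map_mx toC M) z -> normc z < 1.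
Proof.
rewrite /spectral_radius; set E := [set normc z | z in _].
have [r _ rE] := char_poly_roots (map_mx toC M).
have ubE : has_ubound E.
  exists (\sum_(z <- r) normc z) => _ [z /= + <-]; rewrite rE => zr.
  rewrite (big_rem _ zr)/= lerDl sumr_ge0// => *; exact: normc_ge0.
split=> [E1 z zM|M1].
  by apply: le_lt_trans E1; apply: ub_le_sup => //; exists z.
have [->|/set0P E0] := eqVneq E set0; first by rewrite sup0 ltr01.
apply: (@le_lt_trans _ _ (\big[Num.max/0]_(z <- r) normc z)).
  apply: ge_sup => // _ [z /= + <-]; rewrite rE => zr.
  by apply: (@le_bigmax_seq _ F _ r 0 z xpredT (fun z => normc z) zr isT).
rewrite big_seq; apply: (big_ind (fun x => x < 1)) => [||z zr].
- exact: ltr01.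
- by move=> x y x1 y1; rewrite gt_max x1.
- by apply: M1; rewrite rE.
Qed.

Lemma map_Re_mulmx (F : rcfType) (m n p : nat) (W : 'M[F[i]]_(m, n))
    (M : 'M[F]_(n, p)) :
  map_mx (@complex.Re F) (W *m map_mx toC M) = map_mx (@complex.Re F) W *m M.
Proof.
apply/matrixP => i j; rewrite !mxE.
rewrite (big_morph (@complex.Re F) (id1 := 0) (op1 := +%R)) //; last first.
  by move=> [? ?] [? ?].
apply: eq_bigr => k _; rewrite !mxE; case: (W i k) => x y /=; ring.
Qed.

Lemma map_Im_mulmx (F : rcfType) (m n p : nat) (W : 'M[F[i]]_(m, n))
    (M : 'M[F]_(n, p)) :
  map_mx (@complex.Im F) (W *m map_mx toC M) = map_mx (@complex.Im F) W *m M.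
Proof.
apply/matrixP => i j; rewrite !mxE.
rewrite (big_morph (@complex.Im F) (id1 := 0) (op1 := +%R)) //; last first.
  by move=> [? ?] [? ?].
apply: eq_bigr => k _; rewrite !mxE; case: (W i k) => x y /=; ring.
Qed.

(* [a + i b] is a left eigenvector for the eigenvalue [p + i q]. *)
Definition complex_eigenpair (F : realType) (n : nat) (M : 'M[F]_n) (p q : F)
    (a b : 'rV[F]_n) : Prop :=
  a *m M = p *: a - q *: b /\ b *m M = q *: a + p *: b.

(** Splits a complex left eigenvector into real and imaginary parts, so that stability can be tested
    with real quadratic forms. *)
Lemma spectral_radius_lt1P (F : realType) (n : nat) (M : 'M[F]_n) :
  spectral_radius M < 1 <->
  forall p q a b, complex_eigenpair M p q a b -> 1 <= p ^+ 2 + q ^+ 2 ->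
    a = 0 /\ b = 0.
Proof.
rewrite spectral_radius_lt1_normc; split=> [M1 p q a b [aM bM] pq|M1 z].
  pose w : 'rV[F[i]]_n := \row_j (a 0 j +i* b 0 j)%C.
  have Rew : map_mx (@complex.Re F) w = a by apply/rowP => j; rewrite !mxE.
  have Imw : map_mx (@complex.Im F) w = b by apply/rowP => j; rewrite !mxE.
  have wM : w *m map_mx toC M = (p +i* q)%C *: w.
    apply/rowP => j; apply/eqP; rewrite eq_complex; apply/andP; split; apply/eqP.
      have := map_Re_mulmx w M; rewrite Rew aM => /rowP/(_ j).
      by rewrite !mxE.
    have := map_Im_mulmx w M; rewrite Imw bM => /rowP/(_ j).
    by rewrite !mxE => -> /=; rewrite addrC.
  suff w0 : w = 0.
    by rewrite -Rew -Imw w0; split; apply/rowP => j; rewrite !mxE.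
  apply: contraTeq pq => w0; rewrite -ltNge.
  have /M1 : eigenvalue (map_mx toC M) (p +i* q)%C.
    by apply/eigenvalueP; exists w.
  by rewrite -(ltr_sqr _ _)// ?nnegrE ?normc_ge0//= sqr_sqrtr ?expr1n// addr_ge0 ?sqr_ge0.
case/eigenvalueP => w wM; rewrite ltNge; apply: contraNN => z1.
have [||] := M1 (complex.Re z) (complex.Im z) (map_mx (@complex.Re F) w)
  (map_mx (@complex.Im F) w); last first.
- move=> Rew Imw; apply/eqP/rowP => j; apply/eqP; rewrite eq_complex.
  by move/rowP: Rew => /(_ j); move/rowP: Imw => /(_ j); rewrite !mxE => -> ->; rewrite eqxx.
- move: z1; case: z {wM} => p q /=.
  by rewrite -[X in X <= _]sqrtr1 ler_sqrt// addr_ge0 ?sqr_ge0.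
rewrite /complex_eigenpair -map_Re_mulmx -map_Im_mulmx wM.
split; apply/rowP => j; rewrite !mxE; case: z {z1 wM} => ? ?; case: (w 0 j) => ? ? //=.
by rewrite addrC.
Qed.

Lemma cvg0_of_contracting_rec (F : realType) (u b : nat -> F) (r : F) :
  0 <= r -> r < 1 -> (forall k, 0 <= u k) -> (forall k, u k.+1 <= r * u k + b k) ->
  b k @[k --> \oo] --> 0 -> u k @[k --> \oo] --> 0.
Proof.
move=> r0 r1 u0 urec b0; apply/cvgrPdist_lt => e e0.
(* With this [d], [e / 2] is the fixed point of [x |-> r * x + d], and the excess over it decays
   like [r ^+ j]. *)
pose d := e / 2 * (1 - r).
have d0 : 0 < d by rewrite mulr_gt0 ?subr_gt0 ?divr_gt0.
have /cvgrPdist_lt/(_ _ d0)[N _ bN] := b0.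
have uN j : u (N + j)%N <= r ^+ j * u N + e / 2.
  elim: j => [|j IH]; first by rewrite addn0 expr0 mul1r lerDl ltW ?divr_gt0.
  rewrite addnS; apply: le_trans (urec _) _.
  have := bN (N + j)%N (leq_addr _ _); rewrite sub0r normrN => /(le_lt_trans (ler_norm _)) bj.
  have := ler_wpM2l r0 IH; rewrite exprS /d in bj *; lra.
have : (r ^+ j * u N) @[j --> \oo] --> 0 * u N.
  by apply: cvgMr_tmp; apply: cvg_expr; rewrite ger0_norm.
rewrite mul0r => /cvgrPdist_lt/(_ _ (divr_gt0 e0 (ltr0Sn _ 1)))[K _ HK].
exists (N + K)%N => // k /= NKk.
have Nk : (N <= k)%N by apply: leq_trans NKk; rewrite leq_addr.
rewrite sub0r normrN ger0_norm// -(subnKC Nk); apply: le_lt_trans (uN _) _.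
have := HK (k - N)%N; rewrite /= leq_subRL// sub0r normrN => /(_ NKk).
move=> /(le_lt_trans (ler_norm _)); lra.
Qed.

Definition orbit_null (F : realType) (n : nat) (M : 'M[F[i]]_n) (w : 'rV[F[i]]_n) :=
  forall j, normc ((iter k (mulmxr M) w) 0 j) @[k --> \oo] --> (0 : F).

(* The orbits of [w] and [w (M - z)] satisfy [u_{k+1} - z u_k = v_k]. *)
Lemma orbit_null_peel (F : realType) (n : nat) (M : 'M[F[i]]_n) z w :
  normc z < 1 -> orbit_null M (w *m (M - z%:M)) -> orbit_null M w.
Proof.
move=> z1 wz j; apply: cvg0_of_contracting_rec (wz j); [exact: normc_ge0|exact: z1|..].
  by move=> k; exact: normc_ge0.
move=> k; rewrite -ComplexField.Normc.normcM.
apply: le_trans (le_normcD _ _).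
suff -> : iter k.+1 (mulmxr M) w = z *: iter k (mulmxr M) w +
    iter k (mulmxr M) (w *m (M - z%:M)) by rewrite !mxE.
elim: k => [|k IH]; first by rewrite /= mulmxBr mul_mx_scalar addrC subrK.
by rewrite iterS {1}IH /= mulmxDl -scalemxAl.
Qed.

Lemma orbit_null_prod (F : realType) (n : nat) (M : 'M[F[i]]_n.+1) (r : seq F[i]) w :
  (forall z, z \in r -> normc z < 1) ->
  w *m \prod_(z <- r) (M - z%:M) = 0 -> orbit_null M w.
Proof.
elim: r w => [|z r IH] w r1.
  rewrite big_nil mulmx1 => -> j.
  have it0 k : iter k (mulmxr M) (0 : 'rV_n.+1) = 0.
    by elim: k => //= k ->; rewrite mul0mx.
  under eq_fun do rewrite it0 mxE ComplexField.Normc.normc0.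
  exact: cvg_cst.
rewrite big_cons mulmxA => wM; apply: (@orbit_null_peel _ _ _ z).
  by apply: r1; rewrite mem_head.
by apply: IH => // t tr; apply: r1; rewrite in_cons tr orbT.
Qed.

(** By Cayley-Hamilton the product of the [M - z] over the roots [z] of the characteristic
    polynomial kills every vector, and each factor can be peeled off because [z] has modulus less
    than 1. *)
Lemma orbit_cvg0 (F : realType) (n : nat) (M : 'M[F]_n) :
  spectral_radius M < 1 ->
  forall (a : 'rV_n) j, (iter k (mulmxr M) a) 0 j @[k --> \oo] --> 0.
Proof.
case: n M => [|n] M; first by move=> _ a [].
rewrite spectral_radius_lt1_normc => M1 a j.
have [r chM rE] := char_poly_roots (map_mx toC M).
have Mnull : orbit_null (map_mx toC M) (map_mx toC a).
  apply: (@orbit_null_prod _ _ _ r) => [z|]; first by rewrite -rE => /M1.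
  have := Cayley_Hamilton (map_mx toC M); rewrite chM rmorph_prod/=.
  under eq_bigr do rewrite rmorphB /= horner_mx_X horner_mx_C.
  by move=> ->; rewrite mulmx0.
have itE k : iter k (mulmxr (map_mx toC M)) (map_mx toC a) =
    map_mx toC (iter k (mulmxr M) a).
  by elim: k => //= k ->; rewrite map_mxM.
have := Mnull j; under eq_fun do rewrite itE mxE /= expr0n addr0 sqrtr_sqr.
by move/norm_cvg0P.
Qed.

(** * Quadratic forms and Lyapunov inequalities *)

Section QuadraticForms.
Context {F : realType}.

(** Forms act on row vectors, so that congruence by [M] becomes the action [a |-> a *m M] iterated
    in [orbit_cvg0]. *)
Definition qform n (X : 'M[F]_n) (a : 'rV_n) : F := (a *m X *m a^T) 0 0.

(** Symmetry is kept separate, so that comparison by forms also covers covariances built from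
    arbitrary [Q] and [R]. *)
Definition qge0 n (X : 'M[F]_n) := forall a, 0 <= qform X a.

Lemma qformD n (X Y : 'M[F]_n) a : qform (X + Y) a = qform X a + qform Y a.
Proof. by rewrite /qform mulmxDr mulmxDl mxE. Qed.

Lemma qformN n (X : 'M[F]_n) a : qform (- X) a = - qform X a.
Proof. by rewrite /qform mulmxN mulNmx mxE. Qed.

Lemma qformB n (X Y : 'M[F]_n) a : qform (X - Y) a = qform X a - qform Y a.
Proof. by rewrite qformD qformN. Qed.

Lemma qformZ n c (X : 'M[F]_n) a : qform (c *: X) a = c * qform X a.
Proof. by rewrite /qform -scalemxAr -scalemxAl mxE. Qed.

Lemma qform_congr m n (M : 'M[F]_(m, n)) X a :
  qform (M *m X *m M^T) a = qform X (a *m M).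
Proof. by rewrite /qform trmx_mul !mulmxA. Qed.

Lemma qform1_sum n (a : 'rV[F]_n) : qform 1%:M a = \sum_j a 0 j ^+ 2.
Proof. by rewrite /qform mulmx1 mxE; apply: eq_bigr => j _; rewrite !mxE. Qed.

Lemma qform1_ge0 n (a : 'rV[F]_n) : 0 <= qform 1%:M a.
Proof. by rewrite qform1_sum sumr_ge0// => j _; exact: sqr_ge0. Qed.

Lemma qform1_eq0 n (a : 'rV[F]_n) : qform 1%:M a = 0 -> a = 0.
Proof.
rewrite qform1_sum => /eqP; rewrite psumr_eq0 => [/allP a0|j _]; last exact: sqr_ge0.
apply/rowP => j; rewrite mxE; apply/eqP.
by have := a0 j (mem_index_enum _); rewrite sqrf_eq0.
Qed.

Lemma qform_delta n (X : 'M[F]_n) i : qform X (delta_mx 0 i) = X i i.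
Proof. by rewrite /qform -rowE trmx_delta -colE !mxE. Qed.

Lemma trace_ge0 n (X : 'M[F]_n) : qge0 X -> 0 <= \tr X.
Proof. by move=> X0; apply: sumr_ge0 => i _; rewrite -qform_delta. Qed.

Lemma trace_le n (X Y : 'M[F]_n) :
  (forall a, qform X a <= qform Y a) -> \tr X <= \tr Y.
Proof.
move=> XY; rewrite -subr_ge0 -raddfB; apply: trace_ge0 => a.
by rewrite qformB subr_ge0.
Qed.

Lemma qge0_diag_le_trace n (X : 'M[F]_n) i : qge0 X -> X i i <= \tr X.
Proof.
move=> X0; rewrite /mxtrace (bigD1 i)//= lerDl sumr_ge0// => j _.
by rewrite -qform_delta.
Qed.

Lemma qform_sumE n (X : 'M[F]_n) a :
  qform X a = \sum_i \sum_j a 0 i * X i j * a 0 j.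
Proof.
rewrite /qform mxE exchange_big/=; apply: eq_bigr => j _.
by rewrite !mxE mulr_suml; apply: eq_bigr => i _.
Qed.

(** Testing the form on the sum and the difference of two basis vectors bounds twice the entry by
    the sum of two diagonal entries, each at most the trace. *)
Lemma psd_entry_le_trace n (X : 'M[F]_n) i j :
  X^T = X -> qge0 X -> `|X i j| <= \tr X.
Proof.
move=> Xsym X0.
have e s : qform X (delta_mx 0 i + s *: delta_mx 0 j) =
   X i i + s * X i j *+ 2 + s ^+ 2 * X j j.
  rewrite /qform linearD/= linearZ/= !mulmxDr !mulmxDl -!scalemxAr -!scalemxAl.
  rewrite -!rowE !trmx_delta -!colE !mxE.
  have -> : X j i = X i j by rewrite -[in LHS]Xsym mxE.
  by ring.
have := X0 (delta_mx 0 i + 1 *: delta_mx 0 j).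
have := X0 (delta_mx 0 i + (-1) *: delta_mx 0 j); rewrite !e.
have := qge0_diag_le_trace i X0; have := qge0_diag_le_trace j X0.
by rewrite ler_norml => ? ? ? ?; apply/andP; split; lra.
Qed.

Lemma sym_qform_eq0 n (X : 'M[F]_n) :
  X^T = X -> (forall a, qform X a = 0) -> X = 0.
Proof.
move=> Xsym X0; apply/matrixP => i j; rewrite mxE; apply/eqP.
rewrite -normr_le0; have <- : \tr X = 0.
  by rewrite /mxtrace big1// => k _; rewrite -qform_delta.
by rewrite psd_entry_le_trace// => a; rewrite X0.
Qed.

Lemma psdP n (X : 'M[F]_n) : psd X <-> X^T = X /\ qge0 X.
Proof.
split=> -[Xs X0]; split=> // a; have := X0 a^T.
  by rewrite trmxK.
by rewrite /qform trmxK.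
Qed.

Lemma pd_qform_gt0 n (X : 'M[F]_n) a : pd X -> a != 0 -> 0 < qform X a.
Proof.
move=> [_ X0] a0; have := X0 a^T; rewrite trmxK; apply.
by apply: contraNneq a0 => /(congr1 trmx); rewrite trmxK trmx0 => ->.
Qed.

Lemma pd_qge0 n (X : 'M[F]_n) : pd X -> qge0 X.
Proof.
move=> X0 a; have [->|a0] := eqVneq a 0; last exact/ltW/pd_qform_gt0.
by rewrite /qform !mul0mx mxE.
Qed.

Lemma pd_psd n (X : 'M[F]_n) : pd X -> psd X.
Proof. by move=> X0; apply/psdP; split; [case: X0|exact: pd_qge0]. Qed.

Lemma pd_qform_eq0 n (X : 'M[F]_n) a : pd X -> qform X a = 0 -> a = 0.
Proof.
move=> X0 a0; apply: contra_eq a0 => /(pd_qform_gt0 X0); exact: lt0r_neq0.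
Qed.

Lemma pd1 n : pd (1%:M : 'M[F]_n).
Proof.
split=> [|v v0]; first exact: trmx1.
have -> : (v^T *m 1%:M *m v) ord0 ord0 = qform 1%:M v^T by rewrite /qform trmxK.
rewrite lt0r qform1_ge0 andbT; apply: contraNneq v0 => /qform1_eq0.
by move=> /(congr1 trmx); rewrite trmxK trmx0 => ->.
Qed.

Lemma psdD n (X Y : 'M[F]_n) : psd X -> psd Y -> psd (X + Y).
Proof.
move=> /psdP[Xs X0] /psdP[Ys Y0]; apply/psdP; split; first by rewrite linearD/= Xs Ys.
by move=> a; rewrite qformD addr_ge0.
Qed.

Lemma psd_congr m n (M : 'M[F]_(m, n)) X : psd X -> psd (M *m X *m M^T).
Proof.
move=> /psdP[Xs X0]; apply/psdP; split; first by rewrite !trmx_mul trmxK Xs mulmxA.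
by move=> a; rewrite qform_congr.
Qed.

Lemma psd_pdD n (X Y : 'M[F]_n) : psd X -> pd Y -> pd (X + Y).
Proof.
move=> [Xs X0] [Ys Y0]; split; first by rewrite linearD/= Xs Ys.
by move=> v v0; rewrite mulmxDr mulmxDl mxE ltr_wpDl// ?X0// Y0.
Qed.

Lemma pd_unitmx n (X : 'M[F]_n) : pd X -> X \in unitmx.
Proof.
move=> X0; rewrite -row_free_unit -kermx_eq0; apply/rowV0P => a /sub_kermxP aX.
by apply: (pd_qform_eq0 X0); rewrite /qform aX mul0mx mxE.
Qed.

Lemma mulmx_trmx_eq0 m n (K : 'M[F]_(m, n)) : \tr (K *m K^T) = 0 -> K = 0.
Proof.
move=> /eqP; rewrite psumr_eq0 => [/allP K0|i _]; last first.
  by rewrite mxE sumr_ge0// => j _; rewrite mxE -expr2 sqr_ge0.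
apply/row_matrixP => i; rewrite row0; apply: qform1_eq0.
have /eqP K0i := K0 i (mem_index_enum _); rewrite /qform mulmx1 -[RHS]K0i.
by rewrite !mxE; apply: eq_bigr => j _; rewrite !mxE.
Qed.

Lemma entry_le_trace_mulmx_trmx m n (K : 'M[F]_(m, n)) i j :
  K i j ^+ 2 <= \tr (K *m K^T).
Proof.
rewrite /mxtrace (bigD1 i)//= mxE (bigD1 j)//= !mxE expr2 -addrA lerDl addr_ge0//.
  by rewrite sumr_ge0// => k _; rewrite !mxE -expr2 sqr_ge0.
by rewrite sumr_ge0// => k _; rewrite !mxE sumr_ge0// => l _; rewrite !mxE -expr2 sqr_ge0.
Qed.

Lemma qform_bound n (X : 'M[F]_n) :
  exists2 c, 0 <= c & forall a, `|qform X a| <= c * qform 1%:M a.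
Proof.
exists (\sum_i \sum_j `|X i j|).
  by apply: sumr_ge0 => i _; apply: sumr_ge0 => j _.
move=> a; rewrite qform_sumE; apply: le_trans (ler_norm_sum _ _ _) _.
rewrite mulr_suml; apply: ler_sum => i _.
apply: le_trans (ler_norm_sum _ _ _) _; rewrite mulr_suml; apply: ler_sum => j _.
rewrite !normrM mulrAC mulrC; apply: ler_wpM2l => //.
have aj k : `|a 0 k| ^+ 2 <= qform 1%:M a.
  rewrite qform1_sum real_normK ?num_real// (bigD1 k)//= lerDl sumr_ge0// => *; exact: sqr_ge0.
have := aj i; have := aj j; have := sqr_ge0 (`|a 0 i| - `|a 0 j|); nra.
Qed.

End QuadraticForms.

Lemma cvg_sumr (F : realType) (T : Type) (G : set_system T) {FG : Filter G}
    (I : finType) (f : I -> T -> F) (l : I -> F) :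
  (forall i, f i x @[x --> G] --> l i) ->
  (\sum_i f i x) @[x --> G] --> \sum_i l i.
Proof. by move=> fl; apply: cvg_big => //; exact: add_continuous. Qed.

(** * Discrete Lyapunov equations of a stable matrix *)

Section Lyapunov.
Context {F : realType} {n : nat}.
Implicit Types (M X N : 'M[F]_n).

Lemma qform_orbit_cvg0 M X a : spectral_radius M < 1 ->
  qform X (iter k (mulmxr M) a) @[k --> \oo] --> 0.
Proof.
move=> M1; under eq_fun do rewrite qform_sumE.
rewrite [X in nbhs X](_ : 0 = \sum_(i : 'I_n) \sum_(j : 'I_n) 0 * X i j * 0); last first.
  by rewrite big1// => i _; rewrite big1// => j _; rewrite mulr0.
apply: cvg_sumr => i; apply: cvg_sumr => j.
by apply: cvgM; [apply: cvgMr_tmp|]; exact: orbit_cvg0.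
Qed.

(** Along the orbit of [a] the form does not increase and tends to 0, hence it starts out
    nonnegative. This is the comparison principle behind the later bounds on covariances. *)
Lemma lyap_qge0 M X : spectral_radius M < 1 ->
  (forall a, qform (M *m X *m M^T) a <= qform X a) -> qge0 X.
Proof.
move=> M1 XM a; apply: (cvgr_to_le (qform_orbit_cvg0 X a M1)).
apply: nearW; elim=> [|k IH] //=; apply: le_trans IH.
by rewrite -qform_congr.
Qed.

(** As [X] may fail to be symmetric, the bilinear form [a *m X *m b^T] is followed along two orbits:
    it is invariant and tends to 0. *)
Lemma lyap_uniq M X : spectral_radius M < 1 -> X = M *m X *m M^T -> X = 0.
Proof.
move=> M1 XM.
have bil (a b : 'rV_n) : (a *m X *m b^T) 0 0 = 0.
  have itE k : (a *m X *m b^T) 0 0 =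
      (iter k (mulmxr M) a *m X *m (iter k (mulmxr M) b)^T) 0 0.
    by elim: k => //= k ->; rewrite [in LHS]XM trmx_mul !mulmxA.
  suff : (fun=> (a *m X *m b^T) 0 0) @ \oo -->
      \sum_(j : 'I_n) (\sum_(i : 'I_n) 0 * X i j) * 0.
    rewrite [\sum_j _]big1; last by move=> j _; rewrite mulr0.
    by move/(cvg_lim (@norm_hausdorff _ _)); rewrite lim_cst//; exact: norm_hausdorff.
  rewrite [X in X @ _](_ : _ = fun k => \sum_j (\sum_i (iter k (mulmxr M) a) 0 i * X i j) *
     (iter k (mulmxr M) b) 0 j); last first.
    apply/funext => k; rewrite (itE k) mxE; apply: eq_bigr => j _; congr (_ * _).
      by rewrite mxE.
    by rewrite mxE.
  apply: cvg_sumr => j; apply: cvgM; last exact: orbit_cvg0.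
  by apply: cvg_sumr => i; apply: cvgMr_tmp; exact: orbit_cvg0.
apply/matrixP => i j; have := bil (delta_mx 0 i) (delta_mx 0 j).
by rewrite -rowE trmx_delta -colE !mxE.
Qed.

(** The endomorphism [X |-> X - M *m X *m M^T] is injective by [lyap_uniq], hence surjective in
    finite dimension. *)
Lemma lyap_ex M N : spectral_radius M < 1 -> exists X, X = M *m X *m M^T + N.
Proof.
move=> M1; pose f X := X - M *m X *m M^T.
have fl : linear f.
  move=> c X Y; rewrite /f mulmxDr mulmxDl -scalemxAr -scalemxAl scalerBr opprD.
  by rewrite addrACA.
pose fL : {linear _ -> _} := HB.pack f (GRing.isLinear.Build _ _ _ _ f fl).
have fE X : linfun fL X = f X by rewrite lfunE.
have f0 : lker (linfun fL) == 0%VS.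
  apply/lker0P => X Y; rewrite !fE => XY; apply/eqP; rewrite -subr_eq0; apply/eqP.
  apply: (lyap_uniq M1); rewrite mulmxBr mulmxBl; move: XY; rewrite /f.
  set U := M *m X *m _; set V := M *m Y *m _ => XY.
  have -> : X = Y - V + U by rewrite -XY subrK.
  by rewrite addrAC [Y - V]addrC addrK addrC.
have := lker0_lfunVK f0 N; rewrite fE /f.
move: ((linfun fL)^-1%VF N) => X XN; exists X.
by rewrite -XN addrC subrK.
Qed.

End Lyapunov.

(** * Lyapunov equations of the filter *)

(** The complex vector [a + i b] is multiplied by [p + i q], and the sum of the two forms scales
    like a squared modulus. *)
Lemma qform_rotate (F : realType) n (S : 'M[F]_n) (p q : F) a b :
  qform S (p *: a - q *: b) + qform S (q *: a + p *: b) =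
  (p ^+ 2 + q ^+ 2) * (qform S a + qform S b).
Proof.
rewrite !qform_sumE mulrDr !mulr_sumr -!big_split/=; apply: eq_bigr => i _.
rewrite !mulr_sumr -!big_split/=; apply: eq_bigr => j _.
by rewrite !mxE; ring.
Qed.

(* A left eigenvector of [M] for an eigenvalue of modulus at least 1 is killed by [K],
   so it is also an eigenvector of [A]. *)
Lemma stable_of_lyap_le (F : realType) n m (A M S : 'M[F]_n) (K : 'M[F]_(n, m))
    (H : 'M[F]_(m, n)) (R : 'M[F]_m) :
  spectral_radius A < 1 -> M = A - K *m H -> qge0 S -> pd R ->
  (forall a, qform (M *m S *m M^T + K *m R *m K^T) a <= qform S a) ->
  spectral_radius M < 1.
Proof.
move=> /spectral_radius_lt1P A1 ME S0 R0 SM; apply/spectral_radius_lt1P => p q a b [aM bM] pq.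
have [aK bK] : a *m K = 0 /\ b *m K = 0.
  have := SM a; have := SM b; rewrite !qformD !qform_congr aM bM.
  have := qform_rotate S p q a b; have := pd_qge0 R0 (a *m K).
  have := pd_qge0 R0 (b *m K); have := S0 a; have := S0 b.
  move=> Sb Sa Rb Ra rot leb lea.
  (* Adding the inequalities at [a] and [b] then leaves no room for the two nonnegative terms in
     [R]. *)
  have pqS : qform S a + qform S b <= (p ^+ 2 + q ^+ 2) * (qform S a + qform S b).
    by rewrite ler_peMl// addr_ge0.
  by split; apply: (pd_qform_eq0 R0); lra.
apply: (A1 p q) => //; rewrite -[A](subrK (K *m H)) -ME; split.
  by rewrite mulmxDr mulmxA aK mul0mx addr0.
by rewrite mulmxDr mulmxA bK mul0mx addr0.
Qed.

(** Multiplication by [B] carries left eigenvectors of [B *m A] to those of [A *m B], and kills none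
    whose eigenvalue is nonzero. *)
Lemma stable_mulmxC (F : realType) m n (A : 'M[F]_(m, n)) (B : 'M[F]_(n, m)) :
  spectral_radius (A *m B) < 1 -> spectral_radius (B *m A) < 1.
Proof.
move=> /spectral_radius_lt1P AB1; apply/spectral_radius_lt1P => p q a b [aM bM] pq.
have [|//|aB bB] := AB1 p q (a *m B) (b *m B).
  by split; rewrite mulmxA -[_ *m B *m A]mulmxA ?aM ?bM ?mulmxBl ?mulmxDl -!scalemxAl.
move: aM bM; rewrite !mulmxA aB bB !mul0mx => /esym aM /esym bM.
have pq0 : p ^+ 2 + q ^+ 2 != 0 by rewrite gt_eqF// (lt_le_trans ltr01).
(* Multiplying by the conjugate [p - i q] recovers a nonzero multiple of [a]. *)
have a0 : (p ^+ 2 + q ^+ 2) *: a = 0.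
  have -> : (p ^+ 2 + q ^+ 2) *: a = p *: (p *: a - q *: b) + q *: (q *: a + p *: b).
    by apply/rowP => j; rewrite !mxE; ring.
  by rewrite aM bM !scaler0 addr0.
have b0 : (p ^+ 2 + q ^+ 2) *: b = 0.
  have -> : (p ^+ 2 + q ^+ 2) *: b = p *: (q *: a + p *: b) - q *: (p *: a - q *: b).
    by apply/rowP => j; rewrite !mxE; ring.
  by rewrite aM bM !scaler0 subr0.
move/eqP: a0; move/eqP: b0; rewrite !scaler_eq0 (negbTE pq0)/=.
by move=> /eqP -> /eqP ->.
Qed.

Lemma stable_trmx (F : realType) n (M : 'M[F]_n) :
  spectral_radius M < 1 -> spectral_radius M^T < 1.
Proof.
move=> /spectral_radius_lt1_normc M1; apply/spectral_radius_lt1_normc => z; rewrite eigenvalue_root_char => Mz.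
apply: M1; rewrite eigenvalue_root_char; move: Mz; congr (root _ z).
rewrite /char_poly -[RHS]det_tr; congr (\det _); apply/matrixP => i j.
by rewrite !mxE eq_sym.
Qed.

(** * Uniqueness, positivity and trace duality for Lyapunov solutions *)

Section LyapunovEquation.
Context {F : realType} {n : nat}.
Implicit Types (M X N : 'M[F]_n).

Lemma lyap_eq_uniq M N X Y : spectral_radius M < 1 ->
  X = M *m X *m M^T + N -> Y = M *m Y *m M^T + N -> X = Y.
Proof.
move=> M1 XE YE; apply/eqP; rewrite -subr_eq0; apply/eqP.
apply: (lyap_uniq M1); rewrite mulmxBr mulmxBl {1}XE {1}YE.
by rewrite opprD addrACA subrr addr0.
Qed.

Lemma lyap_psd M N X : spectral_radius M < 1 -> psd N ->
  X = M *m X *m M^T + N -> psd X.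
Proof.
move=> M1 /psdP[Ns N0] XE; apply/psdP; split.
  apply: (@lyap_eq_uniq M N) => //.
  by rewrite [in LHS]XE linearD/= !trmx_mul trmxK Ns mulmxA.
apply: (lyap_qge0 M1) => a.
by rewrite [in leRHS]XE qformD lerDl.
Qed.

(** Duality with the adjoint equation: its right-hand side is fixed, so the trace of the solution
    becomes an explicit linear function of [N]. *)
Lemma trace_lyap M N X Y : X = M *m X *m M^T + N -> Y = M^T *m Y *m M + 1%:M ->
  \tr X = \tr (Y *m N).
Proof.
move=> XE YE; have -> : N = X - M *m X *m M^T by rewrite {1}XE addrC addKr.
rewrite mulmxBr raddfB/= !mulmxA [\tr (_ *m M^T)]mxtrace_mulC !mulmxA -raddfB/=.
rewrite -mulmxBl; congr (\tr _); rewrite [X in X - _]YE addrC addKr.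
by rewrite mul1mx.
Qed.

End LyapunovEquation.

(** * Gradient of an affine function of a matrix *)

Section Gradient.
Context {F : realType} {p q : nat}.

Lemma mxtrace_mul_continuous (G : 'M[F]_(p, q)) :
  continuous (fun X : 'M[F]_(p, q) => \tr (G^T *m X)).
Proof.
move=> X; rewrite /mxtrace.
apply: (cvg_sumr (G := nbhs X)) => i; under eq_fun do rewrite mxE; rewrite mxE.
apply: (cvg_sumr (G := nbhs X)) => j; rewrite mxE; apply: cvgMl_tmp.
exact: coord_continuous.
Qed.

(** The differential of an affine function is its linear part, and evaluating it at each
    [delta_mx i j] determines the gradient uniquely. *)
Lemma matrix_gradient_affine (f : 'M[F]_(p, q) -> F) c (G X : 'M[F]_(p, q)) :
  (forall X, f X = c + \tr (G^T *m X)) -> matrix_gradient f X = G.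
Proof.
move=> fE; pose g (X : 'M[F]_(p, q)) : F := \tr (G^T *m X).
have gl : linear g by move=> k Y Z; rewrite /g mulmxDr -scalemxAr raddfD/= linearZ.
pose gL : {linear 'M[F]_(p, q) -> F} :=
  HB.pack g (GRing.isLinear.Build _ _ _ _ g gl).
have gC : continuous gL by exact: mxtrace_mul_continuous.
have gD : is_diff X g g by split; [exact: (@linear_differentiable _ _ _ gL)|exact: (@diff_lin _ _ _ gL)].
have fD : is_diff X f g.
  have -> : f = (cst c : 'M[F]_(p, q) -> F) + g by apply/funext => Y; rewrite fE.
  have {2}-> : g = (0 : 'M[F]_(p, q) -> F) + g by rewrite add0r.
  exact: is_diffD.
apply: xget_unique => [|G' [_ G'E]].
  by split=> [|H]; [exact: ex_diff|rewrite diff_val].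
apply/matrixP => i j; have := G'E (delta_mx i j).
rewrite diff_val /g.
have trE (B : 'M[F]_(p, q)) : \tr (B^T *m delta_mx i j) = B i j.
  rewrite /mxtrace (bigD1 j)//= big1 => [|k kj]; rewrite !mxE.
    rewrite (bigD1 i)//= big1 => [|k ki]; rewrite !mxE ?eqxx ?mulr1 ?addr0//.
    by rewrite (negbTE ki) mulr0.
  by rewrite big1// => l _; rewrite !mxE (negbTE kj) andbF mulr0.
by rewrite !trE.
Qed.

End Gradient.

(** * Error covariance and sensitivity of a stabilizing gain *)

Section FilterError.
Context {F : realType} {n m : nat}.
Variables (A : 'M[F]_n) (C : 'M[F]_(m, n)) (Q : 'M[F]_n) (K : 'M[F]_(n, m)).
Hypothesis K1 : stabilizing A C K.
Local Notation AK := (A - K *m C *m A).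
Local Notation BK := (1%:M - K *m C).

Lemma err_cov_eq (R : 'M[F]_m) : err_cov A C Q K R =
  AK *m err_cov A C Q K R *m AK^T + BK *m Q *m BK^T + K *m R *m K^T.
Proof.
rewrite {1 2}/err_cov; case: xgetP => [P _ //|noP].
have [X XE] := lyap_ex (BK *m Q *m BK^T + K *m R *m K^T) K1.
by case: (noP X); rewrite /= -addrA.
Qed.

Lemma err_cov_uniq (R : 'M[F]_m) P :
  P = AK *m P *m AK^T + BK *m Q *m BK^T + K *m R *m K^T ->
  err_cov A C Q K R = P.
Proof.
move=> PE; apply: (lyap_eq_uniq (N := BK *m Q *m BK^T + K *m R *m K^T) K1).
  by rewrite addrA; exact: err_cov_eq.
by rewrite addrA; exact: PE.
Qed.

Lemma err_cov_psd (R : 'M[F]_m) : psd Q -> psd R -> psd (err_cov A C Q K R).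
Proof.
move=> Q0 R0; apply: (@lyap_psd _ _ _ (BK *m Q *m BK^T + K *m R *m K^T) _ K1).
  by apply: psdD; exact: psd_congr.
by rewrite addrA; exact: err_cov_eq.
Qed.

(** By [trace_lyap] the error is affine in the measurement noise, with gradient [(K^T *m Y *m K)^T]
    where [Y] solves the adjoint equation. The same duality applied to [S] identifies the trace of
    this gradient. *)
Lemma sensitivity_lyap (R : 'M[F]_m) S :
  S = AK *m S *m AK^T + K *m K^T -> sensitivity A C Q R K = \tr S.
Proof.
move=> SE.
have [Y YE] := lyap_ex 1%:M (stable_trmx K1); rewrite trmxK in YE.
rewrite /sensitivity (@matrix_gradient_affine _ _ _ _ (\tr (Y *m (BK *m Q *m BK^T)))
  (K^T *m Y *m K)^T) => [|R'].
  by rewrite mxtrace_tr (trace_lyap SE YE) mulmxA [RHS]mxtrace_mulC mulmxA.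
have := err_cov_eq R'; rewrite -addrA /filter_error => /trace_lyap/(_ YE) ->.
rewrite mulmxDr raddfD/= trmxK; congr (_ + _).
by rewrite !mulmxA mxtrace_mulC !mulmxA.
Qed.

Lemma sens_cov_ex : exists2 S, psd S & S = AK *m S *m AK^T + K *m K^T.
Proof.
have [S SE] := lyap_ex (K *m K^T) K1; exists S => //; apply: lyap_psd SE => //.
by rewrite -[K in K *m _]mulmx1; apply: psd_congr; exact/pd_psd/pd1.
Qed.

End FilterError.

(* Matrix identities that are linear in the products occurring in them. *)
Ltac mx_ring :=
  repeat match goal with |- context [mulmx ?X ?Y] =>
    let Z := fresh "Z" in set Z := (mulmx X Y); clearbody Z end;
  apply/matrixP => ? ?; rewrite !mxE; ring.

(** The left side is quadratic in [X] with leading coefficient [H *m S *m H^T + R], and the equation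
    for [L] absorbs the cross terms. It serves with [H = C] for the Kalman gain, and with
    [H = C *m A] and [R = 1] for the descent. *)
Lemma gain_completion_of_square (F : realType) n m (A S : 'M[F]_n)
    (H : 'M[F]_(m, n)) (R : 'M[F]_m) (L X : 'M[F]_(n, m)) :
  S^T = S -> R^T = R -> L *m (H *m S *m H^T + R) = A *m S *m H^T ->
  (A - X *m H) *m S *m (A - X *m H)^T + X *m R *m X^T =
  A *m S *m A^T - L *m (H *m S *m H^T + R) *m L^T
  + (X - L) *m (H *m S *m H^T + R) *m (X - L)^T.
Proof.
set W := H *m S *m H^T + R => Ss Rs LW.
have WL : W *m L^T = H *m S *m A^T.
  have := congr1 trmx LW; rewrite !trmx_mul trmxK Ss mulmxA => <-.
  by rewrite linearD/= !trmx_mul trmxK Ss Rs mulmxA.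
(* [W] becomes opaque, so that products with it stay atoms for [mx_ring]; its definition survives as
   [WE]. *)
have WE := erefl W; rewrite {2}/W in WE; clearbody W.
have -> : (X - L) *m W *m (X - L)^T = X *m W *m X^T - X *m H *m S *m A^T
    - A *m S *m H^T *m X^T + L *m W *m L^T.
  rewrite linearB/= !mulmxBl !mulmxBr -[X *m W *m L^T]mulmxA WL LW !mulmxA.
  mx_ring.
have -> : (A - X *m H) *m S *m (A - X *m H)^T = A *m S *m A^T
    - X *m H *m S *m A^T - A *m S *m H^T *m X^T + X *m H *m S *m H^T *m X^T.
  rewrite linearB/= trmx_mul !mulmxBl !mulmxBr !mulmxA.
  mx_ring.
have -> : X *m R *m X^T = X *m W *m X^T - X *m H *m S *m H^T *m X^T.
  by rewrite WE mulmxDr mulmxDl !mulmxA; mx_ring.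
mx_ring.
Qed.

(** The matrix [(1 - K C) A] is stable as soon as [A (1 - K C) = A - (A K) C] is. For the gain
    [A K], completing the square turns the Riccati equation into a Lyapunov equation with the extra
    term [Q], which is the inequality asked by [stable_of_lyap_le]. *)
Lemma kalman_gain_stabilizing (F : realType) n m (A : 'M[F]_n) (C : 'M[F]_(m, n)) Q R :
  spectral_radius A < 1 -> psd Q -> pd R -> stabilizing A C (kalman_gain A C Q R).
Proof.
move=> A1 Q0 R0; rewrite /stabilizing /kalman_gain /riccati_sol.
(* In the default case the gain is 0 and the error dynamics is [A] itself. *)
case: xgetP => [S _ [S0 SE]|_]; last by rewrite !mul0mx subr0.
set W := C *m S *m C^T + R in SE *.
have Wpd : pd W by apply: psd_pdD => //; exact: psd_congr.
have [Ws _] := Wpd; have [Ss S0'] := (psdP S).1 S0; have [Rs _] := R0.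
set K := _ *m invmx W.
have -> : A - K *m C *m A = (1%:M - K *m C) *m A by rewrite mulmxBl mul1mx.
apply: stable_mulmxC; rewrite mulmxBr mulmx1 mulmxA.
apply: (@stable_of_lyap_le _ _ _ A _ S (A *m K) C R) => // a.
have KW : A *m K *m W = A *m S *m C^T.
  by rewrite -!mulmxA mulVmx ?mulmx1// pd_unitmx.
rewrite (gain_completion_of_square _ Ss Rs KW) subrr mul0mx mul0mx addr0.
rewrite [in leRHS]SE KW trmx_mul [K^T]trmx_mul trmx_inv Ws trmx_mul trmxK Ss.
by rewrite !mulmxA [in leRHS]qformD lerDl; case/psdP: Q0.
Qed.

(** * Decreasing the sensitivity *)

Section Descent.
Context {F : realType} {n m : nat}.
Variables (A : 'M[F]_n) (C : 'M[F]_(m, n)) (Q : 'M[F]_n) (R : 'M[F]_m).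
Hypothesis hA : spectral_radius A < 1.

(** The difference has one term in [t] and one in [t ^+ 2 <= t], each controlled by
    [qform_bound]. *)
Lemma qform_congr_perturb p q (X : 'M[F]_q) (M D : 'M[F]_(p, q)) :
  exists2 c, 0 <= c & forall t a, 0 <= t <= 1 ->
    `|qform ((M + t *: D) *m X *m (M + t *: D)^T) a - qform (M *m X *m M^T) a|
    <= t * c * qform 1%:M a.
Proof.
have [c1 c10 c1P] := qform_bound (D *m X *m M^T + M *m X *m D^T).
have [c2 c20 c2P] := qform_bound (D *m X *m D^T).
exists (c1 + c2); first exact: addr_ge0.
move=> t a /andP[t0 t1]; rewrite -qformB.
have -> : (M + t *: D) *m X *m (M + t *: D)^T - M *m X *m M^T =
    t *: (D *m X *m M^T + M *m X *m D^T) + t ^+ 2 *: (D *m X *m D^T).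
  rewrite linearD linearZ/= !mulmxDl !mulmxDr -!(scalemxAl, scalemxAr).
  mx_ring.
rewrite qformD !qformZ; apply: le_trans (ler_normD _ _) _.
rewrite (normrM t) (ger0_norm t0) normrM (ger0_norm (sqr_ge0 t)).
have t2 : t ^+ 2 * `|qform (D *m X *m D^T) a| <= t * (c2 * qform 1%:M a).
  apply: ler_pM => //; first exact: sqr_ge0.
  by rewrite expr2 ler_piMr.
have t1' := ler_wpM2l t0 (c1P a).
by apply: le_trans (lerD t1' t2) _; rewrite -mulrDr -mulrA mulrDl.
Qed.

(* [S - S'] solves the Lyapunov equation of [K'] with a right-hand side proportional to
   [(L - K) W (L - K)^T], [L] being the Riccati gain of [S]; if [K = L] then
   [S <= A S A^T], which forces [S = 0]. *)
Lemma sensitivity_descent K e : stabilizing A C K -> K != 0 -> 0 < e ->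
  exists K', [/\ stabilizing A C K',
    filter_error A C Q R K' <= filter_error A C Q R K + e &
    sensitivity A C Q R K' < sensitivity A C Q R K].
Proof.
move=> K1 Kn0 e0.
have [S S0 SE] := sens_cov_ex K1.
have [Ss Sq] := (psdP S).1 S0.
pose H := C *m A; pose W := H *m S *m H^T + 1%:M.
have Wpd : pd W by apply: psd_pdD; [exact: psd_congr|exact: pd1].
pose L := A *m S *m H^T *m invmx W.
have LW : L *m W = A *m S *m H^T by rewrite /L mulmxKV// pd_unitmx.
have I1 : (1%:M : 'M[F]_m)^T = 1%:M by exact: trmx1.
have sq X := gain_completion_of_square X Ss I1 LW.
have AH X : A - X *m C *m A = A - X *m H by rewrite mulmxA.
have SEH : S = (A - K *m H) *m S *m (A - K *m H)^T + K *m 1%:M *m K^T.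
  by rewrite mulmx1 -AH.
pose D := L - K.
have Dn0 : D != 0.
  apply: contraNneq Kn0 => /eqP; rewrite subr_eq0 => /eqP LK.
  have SA a : qform S a <= qform (A *m S *m A^T) a.
    rewrite [in leLHS]SEH sq LK subrr mul0mx mul0mx addr0 qformB.
    by rewrite gerBl qform_congr pd_qge0.
  have NS0 : qge0 (- S).
    apply: (lyap_qge0 hA) => a; rewrite mulmxN mulNmx !qformN lerN2.
    exact: SA.
  have Sz : S = 0.
    apply: sym_qform_eq0 => // a; apply/eqP; rewrite eq_le Sq andbT.
    by have := NS0 a; rewrite qformN oppr_ge0.
  by apply/eqP/mulmx_trmx_eq0; move: SE; rewrite Sz mulmx0 mul0mx add0r => <-; rewrite mxtrace0.
pose Kt t := K + t *: D.
have KtH t : A - Kt t *m C *m A = (A - K *m C *m A) + t *: (- (D *m C *m A)).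
  by rewrite /Kt mulmxDl mulmxDl -!scalemxAl scalerN opprD addrA.
have KtB t : 1%:M - Kt t *m C = (1%:M - K *m C) + t *: (- (D *m C)).
  by rewrite /Kt mulmxDl -!scalemxAl scalerN opprD addrA.
(* The excess over the optimum is [(1 - t) ^+ 2] times that at [K], and
   [1 - (1 - t) ^+ 2 = t * (2 - t)]. *)
have step t : (A - Kt t *m H) *m S *m (A - Kt t *m H)^T + Kt t *m 1%:M *m (Kt t)^T
    = S - (t * (2 - t)) *: (D *m W *m D^T).
  rewrite sq [in RHS]SEH sq.
  have -> : Kt t - L = (t - 1) *: D by rewrite /Kt scalerBl scale1r /D; mx_ring.
  have -> : K - L = - D by rewrite opprB.
  rewrite linearZ linearN/= mulmxN !mulNmx opprK -!scalemxAl -!(scalemxAl, scalemxAr).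
  mx_ring.
(* As [W] dominates the identity, the decrease in trace will be at least [t * (2 - t)] times that of
   [D *m D^T], which is positive. *)
have DWD a : qform (D *m 1%:M *m D^T) a <= qform (D *m W *m D^T) a.
  rewrite !qform_congr /W qformD lerDr.
  by case/psdP: (psd_congr H S0).
(* The old [S] satisfies a Lyapunov inequality for the new gain, which is enough for stability. *)
have Ktst t : 0 < t <= 1 -> stabilizing A C (Kt t).
  move=> /andP[t0 t1]; rewrite /stabilizing AH.
  apply: (stable_of_lyap_le hA (erefl _) Sq (@pd1 F m)) => a.
  rewrite step qformB qformZ gerBl mulr_ge0//; first by rewrite mulr_ge0//; lra.
  by rewrite qform_congr pd_qge0.
have Ktse t : 0 < t <= 1 -> sensitivity A C Q R (Kt t) < sensitivity A C Q R K.
  move=> t01; have := Ktst _ t01 => tst; move: t01 => /andP[t0 t1].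
  have [S' S'0 S'E] := sens_cov_ex tst.
  rewrite (sensitivity_lyap Q tst R S'E) (sensitivity_lyap Q K1 R SE).
  have DE : S - S' = (A - Kt t *m C *m A) *m (S - S') *m (A - Kt t *m C *m A)^T
      + (t * (2 - t)) *: (D *m W *m D^T).
    rewrite mulmxBr mulmxBl [in LHS]S'E AH.
    have -> : (t * (2 - t)) *: (D *m W *m D^T) = S - (S - (t * (2 - t)) *: (D *m W *m D^T)).
      by rewrite subKr.
    rewrite -step mulmx1; mx_ring.
  have c0 : 0 < t * (2 - t) by rewrite mulr_gt0//; lra.
  have /psdP[_ dS] : psd (S - S').
    apply: lyap_psd DE => //; rewrite scalemxAl scalemxAr; apply/psdP; split.
      have [Ws _] := Wpd.
      by rewrite -scalemxAr -scalemxAl linearZ/= !trmx_mul trmxK Ws mulmxA.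
    move=> a; rewrite -scalemxAr -scalemxAl qformZ mulr_ge0//; first exact: ltW.
    by rewrite qform_congr pd_qge0.
  rewrite -subr_gt0 -raddfB/=.
  apply: (@lt_le_trans _ _ (\tr ((t * (2 - t)) *: (D *m 1%:M *m D^T)))).
    rewrite linearZ/= mulr_gt0// mulmx1 lt0r; apply/andP; split.
      by apply: contraNneq Dn0 => /mulmx_trmx_eq0 ->.
    apply: trace_ge0 => a; rewrite -[D in D *m _]mulmx1 qform_congr.
    exact: qform1_ge0.
  apply: trace_le => a; rewrite [in leRHS]DE qformD qformZ qformZ.
  apply: ler_wpDl; first by rewrite qform_congr.
  by rewrite ler_wpM2l// ltW.
pose P := err_cov A C Q K R.
have PE : P = _ := err_cov_eq Q K1 R.
(* [P + d *: Z] will be a supersolution for the new gain: [Z] provides a slack [d * qform 1%:M a]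
   that absorbs perturbations of order [t], at the cost of [d * \tr Z] in the error. *)
have [Z ZE] := lyap_ex 1%:M K1.
have Z0 : psd Z := lyap_psd K1 (pd_psd (@pd1 F n)) ZE.
have [c1 c10 c1P] := qform_congr_perturb P (A - K *m C *m A) (- (D *m C *m A)).
have [c2 c20 c2P] := qform_congr_perturb Q (1%:M - K *m C) (- (D *m C)).
have [c3 c30 c3P] := qform_congr_perturb R K D.
have [c4 c40 c4P] := qform_congr_perturb Z (A - K *m C *m A) (- (D *m C *m A)).
have trZ : 0 <= \tr Z by apply: trace_ge0; case/psdP: Z0.
pose d := e / (\tr Z + 1).
have d0 : 0 < d by rewrite divr_gt0// ltr_wpDl.
have dZ : d * \tr Z <= e.
  by rewrite /d mulrAC ler_pdivrMr ?ltr_wpDl// ler_wpM2l ?(ltW e0)// lerDl.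
(* Since [t * s = d], the four perturbations add up to [d - t * d] times [qform 1%:M a], within the
   slack; the summand [d] keeps [t] at most 1. *)
pose s := d + d * c4 + c1 + c2 + c3.
have ds : d <= s by rewrite /s -!addrA lerDl !addr_ge0// mulr_ge0// ltW.
have s0 : 0 < s by exact: lt_le_trans ds.
pose t := d / s.
have t0 : 0 < t by rewrite divr_gt0.
have t1 : t <= 1 by rewrite ler_pdivrMr// mul1r.
have ts : t * s = d by rewrite divfK// gt_eqF.
have t01 : 0 < t <= 1 by rewrite t0.
have tst := Ktst t t01.
exists (Kt t); split; [exact: tst| |exact: Ktse].
rewrite /filter_error -/P.
have P'E := err_cov_eq Q tst R.
set P' := err_cov A C Q (Kt t) R in P'E *.
apply: (@le_trans _ _ (\tr (P + d *: Z))); last first.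
  by rewrite raddfD/= linearZ/= lerD2l.
apply: trace_le; suff dq : qge0 (P + d *: Z - P').
  by move=> a; rewrite -subr_ge0 -qformB.
apply: (lyap_qge0 tst) => a.
have t01' : 0 <= t <= 1 by rewrite ltW.
have := c1P t a t01'; have := c2P t a t01'; have := c3P t a t01'.
have := c4P t a t01'; rewrite -KtH -KtB -/(Kt t).
have qP : qform P a = qform ((A - K *m C *m A) *m P *m (A - K *m C *m A)^T) a
    + qform ((1%:M - K *m C) *m Q *m (1%:M - K *m C)^T) a + qform (K *m R *m K^T) a.
  by rewrite [in LHS]PE !qformD.
have qP' := congr1 (fun X => qform X a) P'E; rewrite /= !qformD in qP'.
have qZ : qform Z a = qform ((A - K *m C *m A) *m Z *m (A - K *m C *m A)^T) a
    + qform 1%:M a by rewrite [in LHS]ZE qformD.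
have lin (M : 'M[F]_n) X Y : M *m (X + d *: Z - Y) *m M^T =
    M *m X *m M^T + d *: (M *m Z *m M^T) - M *m Y *m M^T.
  by rewrite mulmxBr mulmxBl mulmxDr mulmxDl -scalemxAr -scalemxAl.
rewrite lin !qformB !qformD !qformZ qP qP' qZ.
have q0 := qform1_ge0 a.
have tq : t * c1 * qform 1%:M a + t * c2 * qform 1%:M a + t * c3 * qform 1%:M a
    + d * (t * c4 * qform 1%:M a) <= d * qform 1%:M a.
  rewrite -[X in _ <= X * _]ts /s -subr_ge0.
  rewrite (_ : _ - _ = t * d * qform 1%:M a); first by rewrite mulr_ge0// mulr_ge0// ltW.
  ring.
move=> /(le_trans (ler_norm _)) zt /(le_trans (ler_norm _)) rt.
move=> /(le_trans (ler_norm _)) bt /(le_trans (ler_norm _)) pt.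
have {}zt := ler_wpM2l (ltW d0) zt; rewrite mulrBr in zt.
lra.
Qed.

End Descent.

(** * Existence of optimal gains *)

Section EntrywiseContinuity.
Context {F : realType} {T : topologicalType}.

(** Working entry by entry lets limits of scalar sums and products settle matrix expressions. *)
Definition mx_continuous p q (f : T -> 'M[F]_(p, q)) :=
  forall i j, continuous (fun x => f x i j).

Lemma mx_continuous_cst p q (M : 'M[F]_(p, q)) : mx_continuous (fun=> M).
Proof. by move=> i j x; exact: cvg_cst. Qed.

Lemma mx_continuousD p q (f g : T -> 'M[F]_(p, q)) :
  mx_continuous f -> mx_continuous g -> mx_continuous (fun x => f x + g x).
Proof.
move=> fc gc i j x; under eq_fun do rewrite mxE.
by apply: cvgD; [exact: fc|exact: gc].
Qed.

Lemma mx_continuousB p q (f g : T -> 'M[F]_(p, q)) :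
  mx_continuous f -> mx_continuous g -> mx_continuous (fun x => f x - g x).
Proof.
move=> fc gc i j x; under eq_fun do rewrite !mxE.
by apply: cvgB; [exact: fc|exact: gc].
Qed.

Lemma mx_continuousM p q r (f : T -> 'M[F]_(p, q)) (g : T -> 'M[F]_(q, r)) :
  mx_continuous f -> mx_continuous g -> mx_continuous (fun x => f x *m g x).
Proof.
move=> fc gc i j x; under eq_fun do rewrite mxE.
apply: (cvg_sumr (G := nbhs x)) => k.
by apply: cvgM; [exact: fc|exact: gc].
Qed.

Lemma mx_continuous_trmx p q (f : T -> 'M[F]_(p, q)) :
  mx_continuous f -> mx_continuous (fun x => (f x)^T).
Proof. by move=> fc i j x; under eq_fun do rewrite mxE; exact: fc. Qed.

Lemma mx_continuous_mxtrace p (f : T -> 'M[F]_p) :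
  mx_continuous f -> continuous (fun x => \tr (f x)).
Proof. by move=> fc x; apply: (cvg_sumr (G := nbhs x)) => i; exact: fc. Qed.

Lemma closed_mx_eq p q (f g : T -> 'M[F]_(p, q)) :
  mx_continuous f -> mx_continuous g -> closed [set x | f x = g x].
Proof.
move=> fc gc.
have -> : [set x | f x = g x] =
    \bigcap_(ij in [set: 'I_p * 'I_q]) [set x | f x ij.1 ij.2 - g x ij.1 ij.2 = 0].
  apply/seteqP; split=> [x /= fg ij _ /=|x fg]; first by rewrite fg subrr.
  apply/matrixP => i j; apply/eqP; rewrite -subr_eq0; apply/eqP.
  exact: (fg (i, j)).
apply: closed_bigI => -[i j] _ /=.
apply: (@closed_comp _ _ (fun x => f x i j - g x i j) [set 0]).
  by move=> x _; apply: cvgB; [exact: fc|exact: gc].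
exact: closed_eq.
Qed.

Lemma closed_le_fun (f : T -> F) c : continuous f -> closed [set x | f x <= c].
Proof.
move=> fc; apply: (@closed_comp _ _ f [set y | y <= c]); last exact: closed_le.
by move=> x _; exact: fc.
Qed.

Lemma closed_psd p (f : T -> 'M[F]_p) :
  mx_continuous f -> closed [set x | psd (f x)].
Proof.
move=> fc; have -> : [set x | psd (f x)] = [set x | (f x)^T = f x] `&`
    \bigcap_(a in [set: 'rV[F]_p]) [set x | - qform (f x) a <= 0].
  apply/seteqP; split=> x /=.
    by move=> /psdP[fs f0]; split=> // a _ /=; rewrite oppr_le0.
  by move=> [fs f0]; apply/psdP; split=> // a; have := f0 a I; rewrite /= oppr_le0.
apply: closedI.
  by apply: closed_mx_eq => //; exact: mx_continuous_trmx.
apply: closed_bigI => a _; apply: closed_le_fun => x; apply: cvgN.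
by apply: mx_continuousM; [apply: mx_continuousM => //|]; exact: mx_continuous_cst.
Qed.

End EntrywiseContinuity.

(** * Compactness of the admissible triples *)

Section Existence.
Context {F : realType} {n m : nat}.
Variables (A : 'M[F]_n) (C : 'M[F]_(m, n)) (Q : 'M[F]_n) (R : 'M[F]_m).
Hypotheses (hA : spectral_radius A < 1) (hQ : psd Q) (hR : pd R).

Local Notation dim := (n * m + (n * n + n * n))%N.
Local Notation gain_of v := (vec_mx (lsubmx v) : 'M[F]_(n, m)).
Local Notation err_of v := (vec_mx (lsubmx (rsubmx v)) : 'M[F]_n).
Local Notation sens_of v := (vec_mx (rsubmx (rsubmx v)) : 'M[F]_n).

(* Triples (K, P, S) packed into one row vector.  Stability of [A - K C A] is not
   required: it follows from the equation satisfied by [S >= 0], so that the set is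
   closed. *)
Definition admissible delta s : set 'rV[F]_dim :=
  [set v | psd (err_of v)] `&` [set v | psd (sens_of v)] `&`
  [set v | err_of v = (A - gain_of v *m C *m A) *m err_of v *m
      (A - gain_of v *m C *m A)^T
    + (1%:M - gain_of v *m C) *m Q *m (1%:M - gain_of v *m C)^T
    + gain_of v *m R *m (gain_of v)^T] `&`
  [set v | sens_of v = (A - gain_of v *m C *m A) *m sens_of v *m
      (A - gain_of v *m C *m A)^T + gain_of v *m (gain_of v)^T] `&`
  [set v | \tr (err_of v) <= delta] `&` [set v | \tr (sens_of v) <= s].

Lemma gain_of_continuous : mx_continuous (fun v : 'rV[F]_dim => gain_of v).
Proof.
move=> i j; under eq_fun do rewrite !mxE; exact: coord_continuous.
Qed.

Lemma err_of_continuous : mx_continuous (fun v : 'rV[F]_dim => err_of v).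
Proof.
move=> i j; under eq_fun do rewrite !mxE; exact: coord_continuous.
Qed.

Lemma sens_of_continuous : mx_continuous (fun v : 'rV[F]_dim => sens_of v).
Proof.
move=> i j; under eq_fun do rewrite !mxE; exact: coord_continuous.
Qed.

Lemma admissible_closed delta s : closed (admissible delta s).
Proof.
have KC := gain_of_continuous; have PC := err_of_continuous.
have SC := sens_of_continuous; have cst := @mx_continuous_cst F 'rV[F]_dim.
have AKC : mx_continuous (fun v : 'rV[F]_dim => A - gain_of v *m C *m A).
  by apply: mx_continuousB => //; do 2 apply: mx_continuousM => //.
have BKC : mx_continuous (fun v : 'rV[F]_dim => 1%:M - gain_of v *m C).
  by apply: mx_continuousB => //; apply: mx_continuousM => //.
have congrC p q (f : 'rV[F]_dim -> 'M[F]_(p, q)) g : mx_continuous f ->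
    mx_continuous g -> mx_continuous (fun v => f v *m g v *m (f v)^T).
  move=> fc gc; apply: mx_continuousM; first exact: mx_continuousM.
  exact: mx_continuous_trmx.
rewrite /admissible.
apply: closedI; last exact/closed_le_fun/mx_continuous_mxtrace.
apply: closedI; last exact/closed_le_fun/mx_continuous_mxtrace.
apply: closedI; last first.
  apply: closed_mx_eq => //; apply: mx_continuousD; first exact: congrC.
  by apply: mx_continuousM => //; exact: mx_continuous_trmx.
apply: closedI; last first.
  apply: closed_mx_eq => //; apply: mx_continuousD; last exact: congrC.
  by apply: mx_continuousD; exact: congrC.
by apply: closedI; exact: closed_psd.
Qed.

(** Entries of [P] and [S] are bounded by the traces, and those of [K] because [K *m K^T] is
    dominated by [S]; the set is thus closed in a box. *)
Lemma admissible_compact delta s : compact (admissible delta s).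
Proof.
(* The [+ 1] serves the entries of [K]: from [x ^+ 2 <= s] follows [x <= s + 1], whether or not [x]
   exceeds 1. *)
pose b := `|delta| + `|s| + 1.
apply: (subclosed_compact (@admissible_closed delta s)
  (rV_compact (A := fun=> `[- b, b]%classic) (fun=> @segment_compact _ _ _))).
move=> v [[[[[P0 S0] PE] SE] Pd] Ss] i /=; rewrite in_itv/= -ler_norml.
have [[Psym Pq] [Ssym Sq]] := ((psdP _).1 P0, (psdP _).1 S0).
have le_b x : x <= delta \/ x <= s -> x <= b.
  have := normr_ge0 delta; have := normr_ge0 s; have := ler_norm delta.
  by have := ler_norm s; rewrite /b => ? ? ? ? []; lra.
case: (split_ordP i) => {}i ->.
  case/mxvec_indexP: i => i j.
  have -> : v 0 (lshift _ (mxvec_index i j)) = gain_of v i j by rewrite !mxE.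
  have K2 : gain_of v i j ^+ 2 <= s.
    apply: le_trans (entry_le_trace_mulmx_trmx _ _ _) _; apply: le_trans Ss.
    by apply: trace_le => a; rewrite [in leRHS]SE qformD lerDr qform_congr.
  have : `|gain_of v i j| ^+ 2 <= s by rewrite real_normK ?num_real.
  have := normr_ge0 (gain_of v i j); have := ler_norm s; have := normr_ge0 delta.
  by rewrite /b; nra.
case: (split_ordP i) => {}i ->; case/mxvec_indexP: i => i j.
  have -> : v 0 (rshift _ (lshift _ (mxvec_index i j))) = err_of v i j.
    by rewrite !mxE.
  by apply: le_b; left; apply: le_trans Pd; exact: psd_entry_le_trace.
have -> : v 0 (rshift _ (rshift _ (mxvec_index i j))) = sens_of v i j.
  by rewrite !mxE.
by apply: le_b; right; apply: le_trans Ss; exact: psd_entry_le_trace.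
Qed.

Lemma feasible_admissible delta s K : feasible A C Q R delta K ->
  sensitivity A C Q R K <= s ->
  exists2 v, admissible delta s v & \tr (sens_of v) = sensitivity A C Q R K.
Proof.
move=> [K1 Kd]; have [S S0 SE] := sens_cov_ex K1.
rewrite (sensitivity_lyap Q K1 R SE) => Ss.
exists (row_mx (mxvec K) (row_mx (mxvec (err_cov A C Q K R)) (mxvec S))).
  rewrite /admissible /= !row_mxKr !row_mxKl !mxvecK.
  split=> //; split=> //; split=> //; split; last exact: err_cov_eq.
  by split=> //; exact/err_cov_psd/pd_psd.
by rewrite !row_mxKr mxvecK.
Qed.

(** Stability is recovered from the equation of [S]; uniqueness of Lyapunov solutions then
    identifies the packed [P] with the error covariance. *)
Lemma admissible_feasible delta s v : admissible delta s v ->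
  feasible A C Q R delta (gain_of v) /\
  sensitivity A C Q R (gain_of v) = \tr (sens_of v).
Proof.
move=> [[[[[P0 S0] PE] SE] Pd] Ss].
have K1 : stabilizing A C (gain_of v).
  apply: (stable_of_lyap_le hA (K := gain_of v) (H := C *m A) _ _ (@pd1 F m)).
  - by rewrite mulmxA.
  - exact: ((psdP _).1 S0).2.
  - by move=> a; rewrite mulmx1 -SE.
split; last exact: sensitivity_lyap.
by split=> //; rewrite /filter_error (err_cov_uniq K1 PE).
Qed.

(** Bounding the sensitivity by that of a feasible [K0] makes the set of triples compact and
    nonempty, and gains of larger sensitivity cannot beat the minimizer. *)
Lemma min_sensitivity_attained delta : (exists K, feasible A C Q R delta K) ->
  is_min_sensitivity A C Q R delta (min_sensitivity A C Q R delta).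
Proof.
move=> [K0 K0f]; rewrite /min_sensitivity; apply: xgetPex.
have [v0 v0a _] := feasible_admissible K0f (lexx _).
have [v /set_mem va vmin] : exists2 v,
    v \in admissible delta (sensitivity A C Q R K0) &
    forall u, u \in admissible delta (sensitivity A C Q R K0) ->
      \tr (sens_of v) <= \tr (sens_of u).
  apply: (compact_EVT_min (f := fun v => \tr (sens_of v))).
  - by exists v0.
  - exact: admissible_compact.
  - exact/continuous_subspaceT/mx_continuous_mxtrace/sens_of_continuous.
have [vf vs] := admissible_feasible va.
exists (sensitivity A C Q R (gain_of v)); split; first by exists (gain_of v).
move=> K Kf; rewrite vs.
have [KK0|/ltW K0K] := leP (sensitivity A C Q R K) (sensitivity A C Q R K0).
  have [u ua <-] := feasible_admissible Kf KK0.
  by apply: vmin; rewrite inE.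
by apply: le_trans K0K; case: va.
Qed.

End Existence.

(** The first conjunct certifies that [min_sensitivity] is an attained minimum and not the default
    value of [xget]. *)
Theorem mainTheorem2 (F : realType) (n m : nat)
    (A : 'M[F]_n) (C : 'M[F]_(m, n)) (Q : 'M[F]_n) (R : 'M[F]_m)
    (hA : spectral_radius A < 1) (hQ : psd Q) (hR : pd R) :
  let Pmin := filter_error A C Q R (kalman_gain A C Q R) in
  let Pmax := filter_error A C Q R 0 in
  (forall delta : F, Pmin <= delta ->
     is_min_sensitivity A C Q R delta (min_sensitivity A C Q R delta)) /\
  (forall delta1 delta2 : F,
     Pmin <= delta1 -> delta1 < delta2 -> delta2 <= Pmax ->
     min_sensitivity A C Q R delta2 < min_sensitivity A C Q R delta1).
Proof.
move=> Pmin Pmax.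
have minP delta : Pmin <= delta ->
    is_min_sensitivity A C Q R delta (min_sensitivity A C Q R delta).
  move=> Pd; apply: min_sensitivity_attained => //; exists (kalman_gain A C Q R).
  by split; [exact: kalman_gain_stabilizing|exact: Pd].
split=> // delta1 delta2 Pd1 d12 d2P.
have [[K [[K1 Kd1] <-]] _] := minP _ Pd1.
have [_ min2] := minP delta2 (le_trans Pd1 (ltW d12)).
have Kn0 : K != 0.
  by apply: contraTneq d2P => K0; rewrite -ltNge; move: Kd1; rewrite K0 => /le_lt_trans; exact.
have e0 : 0 < delta2 - delta1 by rewrite subr_gt0.
have [K' [K'1 K'd K's]] := @sensitivity_descent F n m A C Q R hA K _ K1 Kn0 e0.
apply: le_lt_trans K's; apply: min2; split=> //.
by apply: le_trans K'd _; rewrite -lerBrDr subKr.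
Qed.
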